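(* For every $n\geq 2$, the group $D_n$ has a presentation with generators $d_{2,1},d_{3,2},\ldots,d_{n,n-1}$ and the following defining relations: \begin{enumerate} \item[(R1)] $(d_{r+1,r},d_{s+1,s})=1$ for $1\leq r<s\leq n-1$ and $s-r\geq 2$; \item[(R2)] $(d_{r+1,r},(d_{r+1,r},d_{r+2,r+1}))=1$ for $1\leq r\leq n-2$; \item[(R3)] $((d_{r+1,r},d_{r+2,r+1}),(d_{r+2,r+1},d_{r+3,r+2}))=1$ for $1\leq r\leq n-3$. \end{enumerate}
   Context: Let $F_n$ be the free group of rank $n\geq 2$ with basis $x_1,\ldots,x_n$. For $1\leq j<i\leq n$, let $d_{i,j}\in\operatorname{Aut}(F_n)$ be the automorphism with $d_{i,j}(x_i)=x_ix_j$ and $d_{i,j}(x_k)=x_k$ for $k\neq i$. Automorphisms are composed as functions: $(\alpha\beta)(x)=\alpha(\beta(x))$. Set $D_n=\langle d_{i,j}\mid 1\leq j<i\leq n\rangle\leq\operatorname{Aut}(F_n)$. Commutators are $(x,y)=x^{-1}y^{-1}xy$. That a group has a presentation on given elements with given defining relations means that the homomorphism from the abstract group so presented (one abstract generator for each listed element), sending each abstract generator to the corresponding element, is well defined and is an isomorphism. *)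

(* Defs.v *)
From HB Require Import structures.
From mathcomp Require Import all_boot.
From mathcomp Require Import boolp classical_sets functions.

Set Implicit Arguments.
Unset Strict Implicit.
Unset Printing Implicit Defensive.

Local Open Scope group_scope.

Section FreeGroup.
Variable S : choiceType.

(* [(s, true)] stands for s and [(s, false)] for s^-1. *)
Definition letter : Type := (S * bool)%type.
HB.instance Definition _ := Choice.on letter.

Definition linv (a : letter) : letter := (a.1, ~~ a.2).

Definition reduced (w : seq letter) : bool :=
  sorted (fun a b => b != linv a) w.

Record freegroup := FreeGroup { fgword :> seq letter; _ : reduced fgword }.
HB.instance Definition _ := [isSub for fgword].
HB.instance Definition _ := [Choice of freegroup by <:].

Definition fgpush (a : letter) (w : seq letter) : seq letter :=
  if w is b :: w' then if b == linv a then w' else a :: w else [:: a].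

Lemma linvK : involutive linv.
Proof. by case=> s b; rewrite /linv /= negbK. Qed.

Lemma fgpush_reduced a w : reduced w -> reduced (fgpush a w).
Proof.
case: w => [|b w] //=; case: eqP => [_ /path_sorted //|/eqP nb pw] /=.
by rewrite nb.
Qed.

Lemma fgpushK a w : reduced w -> fgpush (linv a) (fgpush a w) = w.
Proof.
case: w => [|b w] /=; first by rewrite linvK eqxx.
case: eqP => [->|_ _] /=; last by rewrite linvK eqxx.
by case: w => [|c w] //= /andP[]; case: eqP.
Qed.

Lemma fgpushVK a w : reduced w -> fgpush a (fgpush (linv a) w) = w.
Proof. by move=> rw; rewrite -{1}(linvK a) fgpushK. Qed.

Lemma fgpush_cons a w : reduced (a :: w) -> fgpush a w = a :: w.
Proof. by case: w => [|b w] //= /andP[/negPf->]. Qed.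

Lemma foldr_fgpush_reduced v u : reduced v -> reduced (foldr fgpush v u).
Proof. by move=> rv; elim: u => //= a u; apply: fgpush_reduced. Qed.

Lemma foldr_fgpush_nil u : reduced u -> foldr fgpush [::] u = u.
Proof.
elim: u => //= a u IH rau; rewrite IH ?fgpush_cons //.
exact: path_sorted rau.
Qed.

Lemma foldr_fgpush1 a v w : reduced w ->
  foldr fgpush w (fgpush a v) = fgpush a (foldr fgpush w v).
Proof.
move=> rw; case: v => [|b v] //=; case: eqP => [->|] //=.
by rewrite fgpushVK // foldr_fgpush_reduced.
Qed.

Definition fgone : freegroup := @FreeGroup [::] isT.

Definition fgmul (u v : freegroup) : freegroup :=
  FreeGroup (foldr_fgpush_reduced u (valP v)).

Lemma reduced_inv w : reduced w -> reduced (rev (map linv w)).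
Proof.
rewrite /reduced rev_sorted sorted_map.
apply: sub_sorted => -[s b] [t c]; rewrite /= /linv /= negbK.
by rewrite !xpair_eqE eq_sym; case: b c => -[].
Qed.

Definition fginv (u : freegroup) : freegroup :=
  FreeGroup (reduced_inv (valP u)).

Lemma fgmulA : associative fgmul.
Proof.
move=> [u ru] [v rv] [w rw]; apply: val_inj => /=.
elim: u {ru} => //= a u ->; rewrite foldr_fgpush1 //.
Qed.

Lemma fgmul1g : left_id fgone fgmul.
Proof. by move=> u; apply: val_inj. Qed.

Lemma fgmulg1 : right_id fgone fgmul.
Proof. by move=> [u ru]; apply: val_inj; apply: foldr_fgpush_nil. Qed.

Lemma fgmulVg : left_inverse fgone fginv fgmul.
Proof.
move=> [u ru]; apply: val_inj => /=.
elim: u ru => //= a u IH rau; have ru := path_sorted rau.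
rewrite rev_cons foldr_rcons.
by rewrite -[X in foldr _ X](_ : u = _) ?IH //= linvK eqxx.
Qed.

Lemma fginvK : involutive fginv.
Proof.
move=> u; apply: val_inj; rewrite /= map_rev revK -map_comp.
by rewrite (eq_map (g := id)) ?map_id //; apply: linvK.
Qed.

Lemma fgmulgV : right_inverse fgone fginv fgmul.
Proof. by move=> u; rewrite -{1}(fginvK u) fgmulVg. Qed.

HB.instance Definition _ :=
  isGroup.Build freegroup fgmulA fgmul1g fgmulg1 fgmulVg fgmulgV.

Definition fggen (s : S) : freegroup := @FreeGroup [:: (s, true)] isT.

Section Lift.
Variables (G : groupType) (f : S -> G).

Definition letter_lift (a : letter) : G := if a.2 then f a.1 else (f a.1)^-1.

(* The homomorphism extending [f]. *)
Definition fglift (w : freegroup) : G := \prod_(a <- fgword w) letter_lift a.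

Lemma letter_liftV a : letter_lift (linv a) = (letter_lift a)^-1.
Proof. by case: a => s [] //=; rewrite /letter_lift /= invgK. Qed.

Lemma fglift_mul : {morph fglift : u v / u * v}.
Proof.
move=> [u ru] [v rv]; rewrite /fglift /=.
elim: u {ru} => [|a u IH] /=; first by rewrite big_nil mul1g.
rewrite big_cons -mulgA -IH; case: (foldr _ _ _) => [|b w] /=.
  by rewrite big_seq1 big_nil mulg1.
case: eqP => [->|_]; last by rewrite big_cons.
by rewrite big_cons letter_liftV mulVKg.
Qed.

HB.instance Definition _ := isMultiplicative.Build freegroup G fglift fglift_mul.

Lemma fglift_gen s : fglift (fggen s) = f s.
Proof. by rewrite /fglift big_seq1. Qed.

End Lift.

Lemma morph1 (G H : groupType) (f : {multiplicative G -> H}) : f 1 = 1.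
Proof. by apply: (mulgI (f 1)); rewrite -gmulfM !mulg1. Qed.

Lemma morphV (G H : groupType) (f : {multiplicative G -> H}) x :
  f x^-1 = (f x)^-1.
Proof. by apply: (mulgI (f x)); rewrite -gmulfM !mulgV morph1. Qed.

Lemma fgword_prod (w : freegroup) : w = \prod_(a <- fgword w) letter_lift fggen a.
Proof.
case: w => w rw /=.
elim: w rw => [|a w IH] rw; first by rewrite big_nil; apply: val_inj.
have rw' := path_sorted rw.
rewrite big_cons -(IH rw'); apply: val_inj => /=.
by case: a rw => s [] rw; rewrite /= fgpush_cons.
Qed.

Lemma freegroup_ext (G : groupType) (f g : {multiplicative freegroup -> G}) :
  (forall s, f (fggen s) = g (fggen s)) -> f =1 g.
Proof.
move=> fg w; rewrite (fgword_prod w); elim: (fgword w) => [|a u IH].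
  by rewrite big_nil !morph1.
rewrite big_cons !gmulfM IH; congr (_ * _).
by case: a => s []; rewrite /letter_lift /= ?morphV fg.
Qed.

End FreeGroup.

Section Closures.
Variable G : groupType.
Implicit Types (A : set G) (H : {pred G}).

Definition gensub A : set G :=
  [set x | forall H, group_closed H -> (forall a, A a -> a \in H) -> x \in H].

Definition normal_closed H :=
  group_closed H /\ {in H, forall x, forall y, x ^ y \in H}.

Definition normal_closure A : set G :=
  [set x | forall H, normal_closed H -> (forall a, A a -> a \in H) -> x \in H].

End Closures.

Section Presented.
Variables (S : choiceType) (R : set (freegroup S)).
Local Notation N := (normal_closure R).

Definition prel (u v : freegroup S) : bool := `[< N (u^-1 * v) >].

Lemma ncl1 : N 1.
Proof. by move=> H [[]]. Qed.

Lemma nclF u v : N u -> N v -> N (u / v).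
Proof.
move=> Nu Nv H nH RH; have [[_ HF] _] := nH.
by apply: HF; [apply: Nu | apply: Nv].
Qed.

Lemma nclV u : N u -> N u^-1.
Proof. by move=> Nu; rewrite -div1g; apply: nclF => //; apply: ncl1. Qed.

Lemma nclM u v : N u -> N v -> N (u * v).
Proof. by move=> Nu Nv; rewrite -(invgK v); apply: nclF => //; apply: nclV. Qed.

Lemma nclJ u v : N u -> N (u ^ v).
Proof. by move=> Nu H nH RH; have [_ HJ] := nH; apply: HJ; apply: Nu. Qed.

Lemma prel_refl : reflexive prel.
Proof. by move=> u; apply/asboolP; rewrite mulVg; apply: ncl1. Qed.

Lemma prel_sym : symmetric prel.
Proof.
move=> u v; apply/asboolP/asboolP => /nclV; rewrite invgM invgK //.
Qed.

Lemma prel_trans : transitive prel.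
Proof.
move=> v u w /asboolP uv /asboolP vw; apply/asboolP.
by have := nclM uv vw; rewrite -mulgA mulVKg.
Qed.

Canonical prel_equiv := EquivRel prel prel_refl prel_sym prel_trans.

(* The group < S | R >: [freegroup S] modulo the normal closure of [R]. *)
Definition presented := {eq_quot prel}%qT.
HB.instance Definition _ := Choice.on presented.
HB.instance Definition _ := EqQuotient.on presented.

Definition ppi (u : freegroup S) : presented := \pi_presented%qT u.

Lemma ppiP u v : reflect (ppi u = ppi v) (prel u v).
Proof. exact: eqquotP. Qed.

Definition pmul (x y : presented) := ppi (repr x * repr y).
Definition pinv (x : presented) := ppi (repr x)^-1.

Lemma repr_ppi u : prel (repr (ppi u)) u.
Proof. by apply/ppiP; rewrite /ppi reprK. Qed.

Lemma ppi_surj x : exists u, x = ppi u.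
Proof. by exists (repr x); rewrite /ppi reprK. Qed.

Lemma pmulE u v : pmul (ppi u) (ppi v) = ppi (u * v).
Proof.
apply/ppiP/asboolP.
have /asboolP Nu := repr_ppi u; have /asboolP Nv := repr_ppi v.
move: (repr _) (repr _) Nu Nv => u' v' Nu Nv.
have := nclM (nclJ u' Nu) Nv.
by rewrite /conjg invgM -!mulgA mulVKg.
Qed.

Lemma pinvE u : pinv (ppi u) = ppi u^-1.
Proof.
apply/ppiP/asboolP; have /asboolP Nu := repr_ppi u.
move: (repr _) Nu => u' Nu; rewrite invgK.
have := nclJ u'^-1 (nclV Nu).
by rewrite /conjg invgM !invgK -!mulgA mulgV mulg1.
Qed.

Lemma pmulA : associative pmul.
Proof.
move=> x y z; case: (ppi_surj x) (ppi_surj y) (ppi_surj z) => [u ->] [v ->] [w ->].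
by rewrite !pmulE mulgA.
Qed.

Lemma pmul1g : left_id (ppi 1) pmul.
Proof. by move=> x; case: (ppi_surj x) => u ->; rewrite pmulE mul1g. Qed.

Lemma pmulg1 : right_id (ppi 1) pmul.
Proof. by move=> x; case: (ppi_surj x) => u ->; rewrite pmulE mulg1. Qed.

Lemma pmulVg : left_inverse (ppi 1) pinv pmul.
Proof. by move=> x; case: (ppi_surj x) => u ->; rewrite pinvE pmulE mulVg. Qed.

Lemma pmulgV : right_inverse (ppi 1) pinv pmul.
Proof. by move=> x; case: (ppi_surj x) => u ->; rewrite pinvE pmulE mulgV. Qed.

HB.instance Definition _ :=
  isGroup.Build presented pmulA pmul1g pmulg1 pmulVg pmulgV.

Lemma ppi_mul : {morph ppi : u v / u * v}.
Proof. by move=> u v; rewrite -pmulE. Qed.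

HB.instance Definition _ :=
  isMultiplicative.Build (freegroup S) presented ppi ppi_mul.

Definition pgen (s : S) : presented := ppi (fggen s).

End Presented.

(* Presentation of the subgroup of [G] with underlying set [D], on the elements
   [g s]: the homomorphism sending each abstract generator [pgen R s] to [g s]
   is well defined on < S | R > and is an isomorphism onto [D]. *)
Definition has_presentation (G : groupType) (D : set G)
    (S : choiceType) (g : S -> G) (R : set (freegroup S)) : Prop :=
  exists phi : {multiplicative presented R -> G},
    (forall s, phi (pgen R s) = g s) /\ set_bij [set: presented R] D phi.

Section Aut.
Variable G : groupType.

Definition is_aut (f : G -> G) : bool :=
  `[< {morph f : x y / x * y} /\ bijective f >].

Record gaut := GAut { gautfun :> G -> G; _ : is_aut gautfun }.
HB.instance Definition _ := [isSub for gautfun].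
HB.instance Definition _ := [Choice of gaut by <:].

Lemma gautM (a : gaut) : {morph a : x y / x * y}.
Proof. by have /asboolP[] := valP a. Qed.

Lemma gaut_bij (a : gaut) : bijective a.
Proof. by have /asboolP[] := valP a. Qed.

Lemma gautP (a b : gaut) : gautfun a =1 gautfun b -> a = b.
Proof. by move=> ab; apply: val_inj; apply: funext. Qed.

Lemma is_aut_id : is_aut id.
Proof. by apply/asboolP; split=> //; exists id. Qed.

Lemma is_aut_comp (a b : gaut) : is_aut (gautfun a \o gautfun b).
Proof.
apply/asboolP; split=> [x y|] /=; first by rewrite !gautM.
by apply: bij_comp; apply: gaut_bij.
Qed.

Lemma gaut_inv_ex (a : gaut) : exists b, cancel (gautfun a) b /\ cancel b a.
Proof. by case: (gaut_bij a) => b ab ba; exists b. Qed.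

Definition gaut_invfun (a : gaut) : G -> G := projT1 (cid (gaut_inv_ex a)).

Lemma gaut_invfunK a : cancel (gautfun a) (gaut_invfun a).
Proof. by rewrite /gaut_invfun; case: (cid _) => b []. Qed.

Lemma gaut_invfunVK a : cancel (gaut_invfun a) (gautfun a).
Proof. by rewrite /gaut_invfun; case: (cid _) => b []. Qed.

Lemma is_aut_inv a : is_aut (gaut_invfun a).
Proof.
apply/asboolP; split=> [x y|].
  apply: (can_inj (gaut_invfunK a)).
  by rewrite gautM !gaut_invfunVK.
by exists a; [apply: gaut_invfunVK | apply: gaut_invfunK].
Qed.

Definition gaut_one : gaut := GAut is_aut_id.
Definition gaut_mul (a b : gaut) : gaut := GAut (is_aut_comp a b).
Definition gaut_inv (a : gaut) : gaut := GAut (is_aut_inv a).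

Lemma gaut_mulA : associative gaut_mul.
Proof. by move=> a b c; apply: gautP. Qed.
Lemma gaut_mul1g : left_id gaut_one gaut_mul.
Proof. by move=> a; apply: gautP. Qed.
Lemma gaut_mulg1 : right_id gaut_one gaut_mul.
Proof. by move=> a; apply: gautP. Qed.
Lemma gaut_mulVg : left_inverse gaut_one gaut_inv gaut_mul.
Proof. by move=> a; apply: gautP => x /=; rewrite gaut_invfunK. Qed.
Lemma gaut_mulgV : right_inverse gaut_one gaut_inv gaut_mul.
Proof. by move=> a; apply: gautP => x /=; rewrite gaut_invfunVK. Qed.

HB.instance Definition _ := isGroup.Build gaut
  gaut_mulA gaut_mul1g gaut_mulg1 gaut_mulVg gaut_mulgV.

End Aut.

(* Indices are shifted by one throughout: x_1, ..., x_n are [fx 0], ...,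
   [fx (n - 1)]. *)
Section Dn.
Variable n : nat.

Definition fx (i : 'I_n) : freegroup 'I_n := fggen i.

Definition dfun (i j : 'I_n) : freegroup 'I_n -> freegroup 'I_n :=
  fglift (fun k => if k == i then fx i * fx j else fx k).

Definition dfunV (i j : 'I_n) : freegroup 'I_n -> freegroup 'I_n :=
  fglift (fun k => if k == i then fx i * (fx j)^-1 else fx k).

HB.instance Definition _ i j :=
  Multiplicative.copy (dfun i j) (fglift _).
HB.instance Definition _ i j :=
  Multiplicative.copy (dfunV i j) (fglift _).

Lemma dfunE i j k : dfun i j (fx k) = if k == i then fx i * fx j else fx k.
Proof. exact: fglift_gen. Qed.

Lemma dfunVE i j k :
  dfunV i j (fx k) = if k == i then fx i * (fx j)^-1 else fx k.
Proof. exact: fglift_gen. Qed.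

Lemma dfunM i j : {morph dfun i j : u v / u * v}.
Proof. exact: gmulfM. Qed.

Lemma dfunVM i j : {morph dfunV i j : u v / u * v}.
Proof. exact: gmulfM. Qed.

Lemma dfun_inv i j u : dfun i j u^-1 = (dfun i j u)^-1.
Proof. exact: morphV. Qed.

Lemma dfun_aut (i j : 'I_n) : (j < i)%N -> is_aut (dfun i j).
Proof.
move=> ji; have /negPf nji : j != i by rewrite neq_ltn ji.
apply/asboolP; split; first exact: gmulfM.
exists (dfunV i j).
  apply: (freegroup_ext (f := dfunV i j \o dfun i j) (g := idfun)) => k /=.
  rewrite -/(fx k) dfunE; case: (k =P i) => [->|/eqP/negPf nki].
    by rewrite dfunVM !dfunVE eqxx nji mulgVK.
  by rewrite dfunVE nki.
apply: (freegroup_ext (f := dfun i j \o dfunV i j) (g := idfun)) => k /=.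
rewrite -/(fx k) dfunVE; case: (k =P i) => [->|/eqP/negPf nki].
  by rewrite dfunM dfun_inv !dfunE eqxx nji mulgK.
by rewrite dfunE nki.
Qed.

Definition dij (i j : 'I_n) (ji : (j < i)%N) : gaut (freegroup 'I_n) :=
  GAut (dfun_aut ji).

Definition Dn : set (gaut (freegroup 'I_n)) :=
  gensub [set a | exists (i j : 'I_n) (ji : (j < i)%N), a = dij ji].

Lemma dlow_subproof (r : 'I_n.-1) : (r < n)%N.
Proof. exact: leq_trans (ltn_ord r) (leq_pred n). Qed.

Lemma dhigh_subproof (r : 'I_n.-1) : (r.+1 < n)%N.
Proof. by case: r => r /=; rewrite ltn_predRL. Qed.

Definition dlow (r : 'I_n.-1) : 'I_n := Ordinal (dlow_subproof r).
Definition dhigh (r : 'I_n.-1) : 'I_n := Ordinal (dhigh_subproof r).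

(* [dsucc r], r = 0, ..., n - 2, is d_{r+2,r+1} in the 1-based indexing. *)
Definition dsucc (r : 'I_n.-1) : gaut (freegroup 'I_n) :=
  @dij (dhigh r) (dlow r) (ltnSn r).

(* A relation u = 1 is recorded as the relator u; [y r] is the abstract
   generator mapped to [dsucc r]. Here [~ u, v] = u^-1 * (v^-1 * (u * v)). *)
Local Notation y := (@fggen 'I_n.-1).

Inductive Dn_relator : freegroup 'I_n.-1 -> Prop :=
| Dn_R1 (r s : 'I_n.-1) : (r < s)%N -> (2 <= s - r)%N ->
    Dn_relator [~ y r, y s]
| Dn_R2 (r s : 'I_n.-1) : s = r.+1 :> nat ->
    Dn_relator [~ y r, [~ y r, y s]]
| Dn_R3 (r s t : 'I_n.-1) : s = r.+1 :> nat -> t = s.+1 :> nat ->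
    Dn_relator [~ [~ y r, y s], [~ y s, y t]].

End Dn.

Arguments Dn n : clear implicits.

(* Main.v *)
Require Import Defs.
From HB Require Import structures.
From mathcomp Require Import all_boot.
From mathcomp Require Import boolp classical_sets functions.
From mathcomp Require Import zify.

(** The group D_n is an iterated semidirect product of free groups.  The
    automorphisms sending the last letter x_n to x_n w, with w a word in
    x_1, ..., x_(n-1), and fixing the other letters form a free group of rank
    n - 1 on d_(n,1), ..., d_(n,n-1); the subgroup D_(n-1) normalises it and acts
    on it as it acts on w.  So D_n is F_(n-1) extended by D_(n-1), and relations
    for D_n are those of D_(n-1) together with the ones saying how the
    d_(r+1,r), r < n - 1, conjugate the d_(n,j).

    The three families of relations hold in D_n because
    (d_(j,i), d_(k,j)) = d_(k,i) and because transvections with unrelated indices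
    commute ([dij_commg], [dij_commute]).  The work lies in the converse.  From
    here on indices start at 0, as in the code.  In an abstract group with
    elements y_r satisfying (R1), (R2) and (R3), the candidate T_j for
    d_(k+1,j) is the iterated commutator (y_j, (y_(j+1), (... y_k))), called
    [chain].  For r < k, the element y_r commutes with all chains ending at k
    except the one starting at r + 1, and y_r T_(r+1) y_r^-1 = T_(r+1) T_r.
    These are exactly the conjugation relations of the semidirect product
    ([tau_equivariant]).

    Hence each element of the presented group that involves only
    y_0, ..., y_k has the form tau(w) h, where h involves only
    y_0, ..., y_(k-1) and tau(w) is a word w in the chains ending at k
    ([initial_span_normal_form]).  Its image in Aut(F_n) sends x_(k+1) to
    x_(k+1) w, because h fixes x_(k+1) ([phi_chain_word],
    [phi_initial_span_fix]).  If the image is trivial then so is w, and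
    induction on k disposes of h ([phi_initial_span_inj]). *)

Set Implicit Arguments.
Unset Strict Implicit.
Unset Printing Implicit Defensive.

Local Open Scope group_scope.

(** * Commutator identities *)

Section CommutatorIdentities.
Variable G : groupType.
Implicit Types a b c x y z : G.

Lemma commuteR x y z : commute x y -> commute x z -> commute x [~ y, z].
Proof.
by move=> xy xz; apply: commuteM; [|apply: commuteM; [|apply: commuteM]] => //;
  apply: commuteV.
Qed.

Lemma commuteJ a x y : commute x y -> commute (x ^ a) (y ^ a).
Proof. by move=> xy; rewrite /commute -!conjMg xy. Qed.

Lemma conjg_commute x y : commute x y -> x ^ y = x.
Proof. by move=> xy; rewrite /conjg xy mulKg. Qed.

Lemma conjgV_commg a b : commute a [~ a, b] -> b ^ a^-1 = b * [~ a, b].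
Proof.
move=> az; rewrite /conjg invgK mulgA (commgC a b).
by rewrite -(mulgA b) az mulgA mulgK.
Qed.

Lemma commMgJ x y z : [~ x * y, z] = [~ x, z] ^ y * [~ y, z].
Proof. by rewrite /commg conjMg invgM /conjg !mulgA !mulgK. Qed.

(** Conjugating X = [~ b, c] by a^-1 multiplies b by z = [~ a, b] and fixes c,
    so it turns X into X * [~ z, c] once z and X commute; hence the commutator
    of a and X is [~ z, c].  It lets an iterated commutator be rebracketed from
    the left. *)
Lemma commgA_commute a b c :
    commute a c -> commute a [~ a, b] -> commute [~ a, b] [~ b, c] ->
  [~ a, [~ b, c]] = [~ [~ a, b], c].
Proof.
move=> ac az zX; rewrite [LHS]commgEr.
have XE : [~ b, c] ^ a^-1 = [~ b, c] * [~ [~ a, b], c].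
  rewrite conjRg conjgV_commg // (conjg_commute (commuteV (commute_sym ac))).
  by rewrite commMgJ (conjg_commute (commute_sym zX)).
have tE := conjg_commute (commute_sym (commuteR az ac)).
by rewrite conjVg -{2}(conjgKV a [~ b, c]) XE (conjMg [~ b, c]) tE mulKg.
Qed.

(** Both b and b * [~ a, b] = b ^ a^-1 commute with x; conjugating the second by
    a, b commutes with x ^ a as well, and [~ a, x] is built from x and x ^ a. *)
Lemma commute_commg_conj a b x :
    commute a [~ a, b] -> commute b x -> commute [~ a, b] x ->
  commute b [~ a, x].
Proof.
move=> az bx zx; rewrite commgEr; apply: commuteM => //.
rewrite conjVg; apply: commuteV; rewrite -(conjgKV a b); apply: commuteJ.
by rewrite conjgV_commg //; apply/commute_sym/commuteM; apply: commute_sym.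
Qed.

End CommutatorIdentities.

(** * Iterated commutators of the generators *)

Section Chains.
Variables (G : groupType) (y : nat -> G).
Hypothesis R1 : forall r s, r.+2 <= s -> commute (y r) (y s).
Hypothesis R2 : forall r, commute (y r) [~ y r, y r.+1].
Hypothesis R3 : forall r, commute [~ y r, y r.+1] [~ y r.+1, y r.+2].

(** The candidate for the transvection multiplying x_(j+e+1) by x_j.  The chains
    that enter one semidirect factor all end at the same index j + e, so the
    recursion moves the start j and not the end. *)
Fixpoint chain e j : G := if e is e'.+1 then [~ y j, chain e' j.+1] else y j.

Lemma commute_chain_below r e j : r.+2 <= j -> commute (y r) (chain e j).
Proof.
elim: e j => [|e IH] j rj /=; first exact: R1.
by apply: commuteR; [apply: R1 | apply: IH; apply: ltnW].
Qed.

(** The two facts are proved together: rebracketing a chain needs the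
    commutation, and the commutation for a longer chain is read off its
    rebracketed form, whose entries are covered by (R3) and (R1). *)
Lemma commute_commg_chain e j :
  commute [~ y j, y j.+1] (chain e.+1 j.+1) /\
  chain e.+2 j = [~ [~ y j, y j.+1], chain e j.+2].
Proof.
have split2 e' j' : commute [~ y j', y j'.+1] (chain e'.+1 j'.+1) ->
    chain e'.+2 j' = [~ [~ y j', y j'.+1], chain e' j'.+2].
  by move=> zT; apply: commgA_commute => //; apply: commute_chain_below.
suff zT : commute [~ y j, y j.+1] (chain e.+1 j.+1).
  by split=> //; apply: split2.
elim: e j => [|e IH] j; first exact: R3.
rewrite split2 //; apply: commuteR; first exact: R3.
by apply/commute_sym/commuteR; apply/commute_sym/commute_chain_below.
Qed.

Lemma commute_chain_bottom e j : commute (y j) (chain e j).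
Proof.
case: e => [|[|e]]; [exact: commute_refl | exact: R2 |].
have [_ ->] := commute_commg_chain e j.
by apply: commuteR; [exact: R2 | apply: commute_chain_below].
Qed.

(** The case that does not reduce to commuting entries is r = j + 1.  It is an
    instance of [commute_commg_conj] with a = y_j, b = y_(j+1) and x the chain
    starting at j + 1. *)
Lemma commute_chain_inside r e j :
  j <= r -> r < j + e -> commute (y r) (chain e j).
Proof.
rewrite leq_eqVlt => /predU1P[<-|].
  by move=> _; apply: commute_chain_bottom.
elim: e j => [|e IH] j jr re; first by lia.
rewrite /=; case: (ltngtP r j.+1) => rj; [lia| |].
  apply: commuteR; first by apply/commute_sym/R1.
  by apply: IH => //; lia.
case: e {IH} re => [|e] re; first by lia.
rewrite rj; have [zT _] := commute_commg_chain e j.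
apply: commute_commg_conj => //; exact: commute_chain_bottom.
Qed.

Lemma chain_conj e r :
  y r * chain e r.+1 = chain e r.+1 * chain e.+1 r * y r.
Proof.
rewrite commgC -[RHS]mulgA -mulgA; congr (_ * _).
exact: (commute_chain_bottom e.+1 r).
Qed.

End Chains.

(** * Homomorphisms out of free and presented groups *)

Section FreeGroups.
Variable S : choiceType.

Lemma freegroup_word_ind (P : freegroup S -> Prop) :
    P 1 -> (forall s u, P u -> P (fggen s * u)) ->
    (forall s u, P u -> P ((fggen s)^-1 * u)) ->
  forall u, P u.
Proof.
move=> P1 PM PV u; rewrite (fgword_prod u).
elim: (fgword u) => [|[s []] w IH]; rewrite ?big_nil // big_cons.
  exact: PM.
exact: PV.
Qed.

HB.instance Definition _ (G : groupType) (a : gaut G) :=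
  isMultiplicative.Build G G (gautfun a) (gautM a).

Lemma gaut_ext (a b : gaut (freegroup S)) :
  (forall s, a (fggen s) = b (fggen s)) -> a = b.
Proof. by move=> ab; apply/gautP/freegroup_ext. Qed.

End FreeGroups.

(** The universal property of a presentation: the kernel of the extension of f
    to the free group is normal and contains R, hence its normal closure. *)
Lemma presented_lift (S : choiceType) (R : set (freegroup S))
    (G : groupType) (f : S -> G) :
    (forall u, R u -> fglift f u = 1) ->
  exists phi : {multiplicative presented R -> G}, forall s, phi (pgen R s) = f s.
Proof.
move=> fR; pose phi (x : presented R) := fglift f (repr x).
have kerN : normal_closed [pred v | fglift f v == 1].
  split=> [|v]; last first.
    by rewrite !inE => /eqP fv w; rewrite inE !gmulfM /= morphV fv mul1g mulVg.
  split=> [|v w]; first by rewrite inE morph1.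
  rewrite !inE => /eqP fv /eqP fw; rewrite gmulfM /= morphV /=.
  by rewrite fv fw divg1.
have phiE u : phi (ppi R u) = fglift f u.
  have /asboolP /(_ _ kerN) := repr_ppi R u.
  rewrite inE gmulfM /= morphV mulg_eq1 eqg_inv eq_sym => fu.
  by apply/esym/eqP/fu => v /fR; rewrite inE => ->.
have phiM : {morph phi : x y / x * y}.
  move=> x y; case: (ppi_surj x) (ppi_surj y) => [u ->] [v ->].
  by rewrite -gmulfM !phiE gmulfM.
pose phi_mul := isMultiplicative.Build (presented R) G phi phiM.
pose phi_hom : {multiplicative presented R -> G} := HB.pack phi phi_mul.
by exists phi_hom => s; rewrite /= phiE fglift_gen.
Qed.

Lemma ppi_relator (S : choiceType) (R : set (freegroup S)) u : R u -> ppi R u = 1.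
Proof.
by move=> Ru; apply/esym/ppiP/asboolP; rewrite invg1 mul1g => H _; apply.
Qed.

Lemma morphR (G H : groupType) (f : {multiplicative G -> H}) x y :
  f [~ x, y] = [~ f x, f y].
Proof. by rewrite /commg /conjg !gmulfM !morphV. Qed.

(** With g = f \o phi the conclusion says that conjugation by a realises phi on
    the image of f. *)
Lemma freegroup_intertwine (S : choiceType) (G : groupType)
    (f g : {multiplicative freegroup S -> G}) (a : G) :
  (forall s, a * f (fggen s) = g (fggen s) * a) -> forall u, a * f u = g u * a.
Proof.
move=> fg; elim/freegroup_word_ind => [|s u IH|s u IH].
- by rewrite !morph1 mulg1 mul1g.
- by rewrite !gmulfM mulgA fg -!mulgA IH.
rewrite !gmulfM !morphV -mulgA -IH; apply: (mulgI (g (fggen s))).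
by rewrite mulVKg mulgA -fg -mulgA mulVKg.
Qed.

(** * Relations between transvections *)

Section Transvections.
Variable n : nat.
Implicit Types i j k l : 'I_n.

Lemma dijE i j (ji : j < i) k :
  dij ji (fx k) = if k == i then fx i * fx j else fx k.
Proof. exact: dfunE. Qed.

Lemma dij_commg i j k (ij : i < j) (jk : j < k) (ik : i < k) :
  [~ dij ij, dij jk] = dij ik.
Proof.
apply: (mulgI (dij jk * dij ij)); rewrite -commgC.
have [/negPf ijF /negPf ikF] : i != j /\ i != k by rewrite !neq_ltn ij ik.
have [/negPf jkF /negPf kjF] : j != k /\ k != j by rewrite !neq_ltn jk orbT.
apply: gaut_ext => l.
change (dij ij (dij jk (fx l)) = dij jk (dij ij (dij ik (fx l)))).
have [->|lk] := eqVneq l k.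
  by rewrite !(gautM, dijE, eqxx, kjF, ijF, ikF) mulgA.
have [->|lj] := eqVneq l j.
  by rewrite !(gautM, dijE, eqxx, jkF, ikF).
by rewrite !(dijE, negPf lk, negPf lj).
Qed.

Lemma dij_commute i j k l (ji : j < i) (lk : l < k) :
  i != k -> i != l -> k != j -> commute (dij ji) (dij lk).
Proof.
move=> /negPf ikF ilF kjF; apply: gaut_ext => m.
have [kiF liF jkF] : [/\ (k == i) = false, (l == i) = false & (j == k) = false].
  by split; rewrite eq_sym //; apply: negbTE.
change (dij ji (dij lk (fx m)) = dij lk (dij ji (fx m))).
have [->|mk] := eqVneq m k.
  by rewrite !(gautM, dijE, eqxx, kiF, liF).
have [->|mi] := eqVneq m i.
  by rewrite !(gautM, dijE, eqxx, ikF, jkF).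
by rewrite !(dijE, negPf mk, negPf mi).
Qed.

Lemma dsuccE (r : 'I_n.-1) i j (ji : j < i) : i = r.+1 :> nat -> j = r :> nat ->
  dsucc r = dij ji.
Proof.
move=> ir jr; have ei : i = dhigh r by apply: val_inj.
have ej : j = dlow r by apply: val_inj.
by subst i j; apply: gautP.
Qed.

Lemma dsucc_commg (r s : 'I_n.-1) : s = r.+1 :> nat ->
  exists lt_rs : dlow r < dhigh s, [~ dsucc r, dsucc s] = dij lt_rs.
Proof.
move=> sr; have lt_rs : dlow r < dhigh s by rewrite /= sr; lia.
have lt_s : dhigh r < dhigh s by rewrite /= sr.
exists lt_rs; rewrite (@dsuccE s _ _ lt_s) //; exact: dij_commg.
Qed.

Lemma dsucc_relators u : @Dn_relator n u -> fglift (@dsucc n) u = 1.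
Proof.
case=> [r s _ rs | r s sr | r s t sr ts]; rewrite !morphR /= !fglift_gen;
  apply/eqP/commgP.
- by apply: dij_commute; rewrite -val_eqE /=; lia.
- have [lt_rs ->] := dsucc_commg sr.
  by apply: dij_commute; rewrite -val_eqE /=; lia.
have [lt_rs ->] := dsucc_commg sr; have [lt_st ->] := dsucc_commg ts.
by apply: dij_commute; rewrite -val_eqE /=; lia.
Qed.

End Transvections.

(** * The presented group and its action *)

Section NormalForm.
Variable n : nat.
Implicit Types i j : 'I_n.
Local Notation P := (presented (@Dn_relator n)).

(** Setting the generators with index n - 1 or more to 1 keeps (R1), (R2) and
    (R3) true for all natural indices, so that chains need no bounds. *)
Definition absgen (r : nat) : P :=
  if insub r is Some i then pgen (@Dn_relator n) i else 1.

Lemma absgen_ord (r : 'I_n.-1) : absgen r = pgen (@Dn_relator n) r.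
Proof. by rewrite /absgen valK. Qed.

Lemma absgen_out r : n.-1 <= r -> absgen r = 1.
Proof. by move=> nr; rewrite /absgen insubN // -leqNgt. Qed.

Lemma absgenP r :
  absgen r = 1 \/ exists2 i : 'I_n.-1, r = i :> nat & absgen r = ppi _ (fggen i).
Proof.
have [nr|rn] := leqP n.-1 r; first by left; apply: absgen_out.
by right; exists (Ordinal rn) => //; apply: (absgen_ord (Ordinal rn)).
Qed.

Lemma absgen_R1 r s : r.+2 <= s -> commute (absgen r) (absgen s).
Proof.
move=> rs; apply/commgP; case: (absgenP r) => [->|[i ri ->]]; rewrite ?comm1g //.
case: (absgenP s) => [->|[j sj ->]]; rewrite ?commg1 // -morphR.
by apply/eqP/ppi_relator/Dn_R1; lia.
Qed.

Lemma absgen_R2 r : commute (absgen r) [~ absgen r, absgen r.+1].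
Proof.
apply/commgP; case: (absgenP r) => [->|[i ri ->]]; rewrite ?comm1g //.
case: (absgenP r.+1) => [->|[j rj ->]]; rewrite ?commg1 //.
have ij : j = i.+1 :> nat by rewrite -rj ri.
by have := ppi_relator (Dn_R2 ij); rewrite !morphR /= => ->.
Qed.

Lemma absgen_R3 r :
  commute [~ absgen r, absgen r.+1] [~ absgen r.+1, absgen r.+2].
Proof.
apply/commgP; case: (absgenP r) => [->|[i ri ->]]; rewrite ?comm1g //.
case: (absgenP r.+1) => [->|[j rj ->]]; rewrite ?(comm1g, commg1) //.
case: (absgenP r.+2) => [->|[k rk ->]]; rewrite ?commg1 //.
have ij : j = i.+1 :> nat by rewrite -rj ri.
have jk : k = j.+1 :> nat by rewrite -rk rj.
by have := ppi_relator (Dn_R3 ij jk); rewrite !morphR /= => ->.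
Qed.

Local Notation T := (chain absgen).

(** The homomorphism sending x_j to the chain from j to k.  Letters beyond x_k
    are sent to 1, so that every k is handled on the same free group; [trunc] is
    the retraction that kills these letters. *)
Definition tau k : freegroup 'I_n -> P :=
  fglift (fun j : 'I_n => if j <= k then T (k - j) j else 1).
HB.instance Definition _ k := Multiplicative.copy (tau k) (fglift _).

Lemma tau_gen k j : tau k (fx j) = if j <= k then T (k - j) j else 1.
Proof. exact: fglift_gen. Qed.

Definition trunc k : freegroup 'I_n -> freegroup 'I_n :=
  fglift (fun j => if j <= k then fx j else 1).
HB.instance Definition _ k := Multiplicative.copy (trunc k) (fglift _).

Lemma trunc_gen k j : trunc k (fx j) = if j <= k then fx j else 1.
Proof. exact: fglift_gen. Qed.

Lemma tau_trunc k w : tau k (trunc k w) = tau k w.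
Proof.
apply: (freegroup_ext (f := tau k \o trunc k) (g := tau k)) => j /=.
by rewrite trunc_gen tau_gen; case: ifP => jk; rewrite ?tau_gen ?jk ?morph1.
Qed.

(** The subgroup generated by the first k generators.  Its elements are built by
    multiplication on the left because that is where the normal form absorbs
    new factors. *)
Inductive initial_span k : P -> Prop :=
| initial_span1 : initial_span k 1
| initial_spanM r x : r < k -> initial_span k x -> initial_span k (absgen r * x)
| initial_spanV r x : r < k -> initial_span k x ->
    initial_span k ((absgen r)^-1 * x).

Lemma initial_span_all x : initial_span n.-1 x.
Proof.
have [u ->] := ppi_surj x.
elim/freegroup_word_ind: u => [|s u IH|s u IH].
- by rewrite morph1; apply: initial_span1.
- by rewrite gmulfM; have := initial_spanM (ltn_ord s) IH; rewrite absgen_ord.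
rewrite gmulfM morphV.
by have := initial_spanV (ltn_ord s) IH; rewrite absgen_ord.
Qed.

Variable phi : {multiplicative P -> gaut (freegroup 'I_n)}.
Hypothesis phi_gen : forall s, phi (pgen _ s) = dsucc s.

Lemma phi_absgen r i j (ji : j < i) : i = r.+1 :> nat -> j = r :> nat ->
  phi (absgen r) = dij ji.
Proof.
move=> ir jr; have rn : r < n.-1 by have := ltn_ord i; lia.
by rewrite (absgen_ord (Ordinal rn)) phi_gen; apply: dsuccE.
Qed.

(** A chain unfolds by (d_(j+1,j), d_(i,j+1)) = d_(i,j). *)
Lemma phi_chain e i j (ji : j < i) : i = (j + e).+1 :> nat ->
  phi (T e j) = dij ji.
Proof.
elim: e j ji => [|e IH] j ji ije /=; first by apply: phi_absgen => //; lia.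
have j1n : j.+1 < n by have := ltn_ord i; lia.
have j1i : Ordinal j1n < i by rewrite /=; lia.
rewrite morphR (IH (Ordinal j1n) j1i); last by rewrite /=; lia.
by rewrite (@phi_absgen _ (Ordinal j1n) j (ltnSn j)) // dij_commg.
Qed.

(** The conjugation relations of the semidirect product in one statement: y_r
    acts on the chains ending at k as its image acts on the free group. *)
Lemma tau_equivariant k r w : r < k -> k.+1 < n ->
  absgen r * tau k w = tau k (phi (absgen r) w) * absgen r.
Proof.
move=> rk kn; have r1n : r.+1 < n by lia.
have rn : r < n by lia.
rewrite (@phi_absgen _ (Ordinal r1n) (Ordinal rn) (ltnSn r)) //.
apply: (freegroup_intertwine (f := tau k) (g := tau k \o dij _)) => j /=.
rewrite -/(fx j) dfunE -val_eqE /=; case: eqP => [jr|/eqP jr]; last first.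
  rewrite tau_gen; case: leqP => jk; last by rewrite mulg1 mul1g.
  case: (ltnP j r.+1) => [jr1|rj].
    apply: commute_chain_inside; try lia.
    - exact: absgen_R1.
    - exact: absgen_R2.
    exact: absgen_R3.
  by apply: commute_chain_below; [exact: absgen_R1|lia].
rewrite gmulfM /= !tau_gen /= jr rk (ltnW rk).
rewrite (_ : k - r = (k - r.+1).+1); last by lia.
by apply: chain_conj; [exact: absgen_R1|exact: absgen_R2|exact: absgen_R3].
Qed.

(** Left multiplication by y_k is absorbed into w, since y_k is the chain from k
    to k; left multiplication by an earlier y_r passes through tau by
    equivariance and is absorbed into h. *)
Lemma initial_span_normal_form k x : k.+1 < n -> initial_span k.+1 x ->
  exists w, exists2 h, initial_span k h & x = tau k w * h.
Proof.
move=> kn; have kn' : k < n by lia.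
have tau_top : absgen k = tau k (fx (Ordinal kn')).
  by rewrite tau_gen /= leqnn subnn.
elim=> [|r {}x rk _ [w [h hk ->]]|r {}x rk _ [w [h hk ->]]].
- by exists 1, 1; [exact: initial_span1|rewrite morph1 mulg1].
- move: rk; rewrite ltnS leq_eqVlt => /predU1P[->|rk].
    by exists (fx (Ordinal kn') * w), h => //; rewrite tau_top gmulfM mulgA.
  exists (phi (absgen r) w), (absgen r * h); first exact: initial_spanM.
  by rewrite mulgA tau_equivariant // mulgA.
move: rk; rewrite ltnS leq_eqVlt => /predU1P[->|rk].
  exists ((fx (Ordinal kn'))^-1 * w), h => //.
  by rewrite tau_top gmulfM /= morphV mulgA.
(* Equivariance at the word whose image under y_r is w. *)
exists ((phi (absgen r))^-1 w), ((absgen r)^-1 * h); first exact: initial_spanV.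
apply: (mulgI (absgen r)); rewrite mulVKg mulgA tau_equivariant //.
rewrite -[phi (absgen r) _]/((phi (absgen r) * (phi (absgen r))^-1) w) mulgV.
by rewrite !mulgA mulgK.
Qed.

(** The image of each chain ending at k multiplies x_(k+1) on the right by a
    letter and fixes the letters up to x_k, so the factors accumulate in
    order. *)
Lemma phi_chain_word k i w : i = k.+1 :> nat ->
  phi (tau k w) (fx i) = fx i * trunc k w.
Proof.
move=> ik.
(* The image of a single chain, or the identity for a letter beyond x_k. *)
pose d (s : 'I_n) : gaut (freegroup 'I_n) := phi (tau k (fx s)).
have dE s j : d s (fx j) = if (j == i) then fx i * trunc k (fx s) else fx j.
  rewrite /d tau_gen trunc_gen; case: leqP => sk.
    have si : s < i by rewrite ik.
    by rewrite (@phi_chain _ i s si) ?dijE //; rewrite subnKC.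
  by rewrite morph1 /= mulg1; case: eqP => [->|].
have dtrunc s v : d s (trunc k v) = trunc k v.
  apply: (freegroup_ext (f := d s \o trunc k) (g := trunc k)) => j /=.
  rewrite -/(fx j) trunc_gen; case: leqP => jk; last by rewrite morph1.
  by rewrite dE -val_eqE /= ik ltn_eqF.
elim/freegroup_word_ind: w => [|s u IH|s u IH].
- by rewrite !morph1 mulg1.
- rewrite !gmulfM /=.
  change (d s (phi (tau k u) (fx i)) = fx i * (trunc k (fx s) * trunc k u)).
  by rewrite IH (gautM (d s) (fx i)) dtrunc dE eqxx mulgA.
apply: (bij_inj (gaut_bij (d s))).
rewrite !gmulfM !morphV /=.
rewrite -[LHS]/((d s * ((d s)^-1 * phi (tau k u))) (fx i)) mulVKg IH.
by rewrite -/(fx s) !dtrunc dE eqxx !mulgA mulgK.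
Qed.

Lemma phi_initial_span_fix k i x :
  k < i -> initial_span k x -> phi x (fx i) = fx i.
Proof.
move=> ki.
have fixr r : r < k -> phi (absgen r) (fx i) = fx i.
  move=> rk; have r1n : r.+1 < n by have := ltn_ord i; lia.
  have rn : r < n by lia.
  rewrite (@phi_absgen _ (Ordinal r1n) (Ordinal rn) (ltnSn r)) //.
  by rewrite dijE -val_eqE /= gtn_eqF //; lia.
elim=> [|r {}x rk _ IH|r {}x rk _ IH]; first by rewrite morph1.
  rewrite gmulfM -[LHS]/(phi (absgen r) (phi x (fx i))) IH; exact: fixr.
apply: (bij_inj (gaut_bij (phi (absgen r)))).
rewrite gmulfM morphV -[LHS]/((phi (absgen r) * (_ * phi x)) (fx i)).
by rewrite mulVKg IH fixr.
Qed.

(** If tau(w) h acts trivially, its value at x_(k+1) shows that the truncation of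
    w is 1, hence tau(w) = 1, and h lies one level lower. *)
Lemma phi_initial_span_inj k x :
  k < n -> initial_span k x -> phi x = 1 -> x = 1.
Proof.
elim: k x => [|k IH] x kn; first by case.
move=> /(initial_span_normal_form kn)[w [h hk ->]]; set i := Ordinal kn.
rewrite gmulfM => wh1.
have : phi (tau k w) (phi h (fx i)) = fx i.
  by rewrite -[LHS]/((phi (tau k w) * phi h) (fx i)) wh1.
rewrite (@phi_initial_span_fix k i h) // phi_chain_word // -[RHS]mulg1.
move=> /mulgI w1.
move: wh1; rewrite -tau_trunc w1 !morph1 !mul1g; apply: IH => //; exact: ltnW.
Qed.

Lemma phi_inj : 0 < n -> injective phi.
Proof.
move=> n0 x z xz; apply/(mulIg z^-1); rewrite mulgV.
have nn : n.-1 < n by rewrite ltn_predL.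
apply: (phi_initial_span_inj nn (initial_span_all _)).
by rewrite gmulfM morphV xz mulgV.
Qed.

Lemma phi_Dn x : Dn n (phi x).
Proof.
move=> H clH DH; have [H1 _] := clH.
have gH (s : 'I_n.-1) : dsucc s \in H.
  by apply: DH; exists (dhigh s), (dlow s), (ltnSn s).
have [u ->] := ppi_surj x.
elim/freegroup_word_ind: u => [|s u IH|s u IH]; first by rewrite !morph1.
  by rewrite !gmulfM; apply: (group_closedM clH) => //; rewrite phi_gen gH.
rewrite !gmulfM; apply: (group_closedM clH) => //.
by rewrite !morphV; apply: (group_closedV clH); rewrite phi_gen gH.
Qed.

Lemma phi_onto a : Dn n a -> exists x, phi x = a.
Proof.
pose H := [pred b | `[< exists x, phi x = b >]].
have HP b : reflect (exists x, phi x = b) (b \in H) by exact: asboolP.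
move=> /(_ H) aD; apply/HP/aD => [|_ [i [j [ji ->]]]].
  split=> [|b c /HP[x <-] /HP[z <-]]; apply/HP; first by exists 1; apply: morph1.
  by exists (x / z); rewrite gmulfM morphV.
by apply/HP; exists (T (i - j.+1) j); apply: phi_chain; lia.
Qed.

End NormalForm.

Theorem theorem1 (n : nat) (n_ge2 : (2 <= n)%N) :
  has_presentation (Dn n) (@dsucc n) (@Dn_relator n).
Proof.
have [phi phi_gen] := presented_lift (@dsucc_relators n).
exists phi; split=> //; split=> [x _|x z _ _|a /(phi_onto phi_gen)[x <-]].
- exact: phi_Dn.
- by apply: (phi_inj phi_gen); apply: ltnW.
by exists x.
Qed.
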